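(* Let $n\ge 1$ and let $M\in\mathcal{M}_n(\mathbb{Z})$ have rank $r$. Then $$\tau_n(T,M)\gg_M T^{\lfloor r^2/2\rfloor+n(n-r)},$$ i.e. there are constants $c>0$ and $T_0\ge 1$, depending only on $n$ and $M$, such that $\tau_n(T,M)\ge c\,T^{\lfloor r^2/2\rfloor+n(n-r)}$ for all $T\ge T_0$.
   Context: $\mathcal{M}_n(\mathbb{Z})$ is the set of $n\times n$ integer matrices. For a matrix $A=(a_{ij})$, $|A|=\max_{i,j}|a_{ij}|$. For $T\ge 1$ and $M\in\mathcal{M}_n(\mathbb{Z})$, $$\tau_n(T,M)=\#\{(A,B)\in\mathcal{M}_n(\mathbb{Z})^2:\ |A|,|B|\le T,\ AB=M\}.$$ *)

(* Defs.v *)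
From mathcomp Require Import all_boot all_order all_algebra.
From mathcomp Require Import finmap.
From mathcomp Require Import all_classical all_reals.
From mathcomp Require Import topology normedtype.

Set Implicit Arguments.
Unset Strict Implicit.
Unset Printing Implicit Defensive.

Import Order.TTheory GRing.Theory Num.Theory.

Local Open Scope classical_set_scope.
Local Open Scope ring_scope.

(* [mx_norm] is the largest absolute value of an entry (0 for an empty
   matrix); over [int] it is an [int], hence the cast to [R]. *)
Definition factorizations (R : realType) (n : nat) (T : R) (M : 'M[int]_n) :
    set ('M[int]_n * 'M[int]_n) :=
  [set AB | [/\ (mx_norm AB.1)%:~R <= T, (mx_norm AB.2)%:~R <= T
              & AB.1 *m AB.2 = M]].

Lemma mx_norm_intP (R : realType) (n : nat) (T : R) (A : 'M[int]_n) :
  0 <= T ->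
  (mx_norm A)%:~R <= T <-> (forall i j, `|A i j|%:~R <= T).
Proof.
move=> T0; split=> [AT i j|AT].
  apply: le_trans AT; rewrite ler_int mx_normrE.
  by apply/bigmax_geP; right; exists (i, j).
have [->|/mx_norm_neq0[[i j] ->]] := eqVneq (mx_norm A) 0; first by [].
exact: AT.
Qed.

Lemma finite_mx_norm_le (R : realType) (n : nat) (T : R) :
  finite_set [set A : 'M[int]_n | (mx_norm A)%:~R <= T].
Proof.
have [T0|T0] := leP 0 T; last first.
  apply: (sub_finite_set _ (finite_set0 _)) => A /= AT.
  have : 0 <= (mx_norm A)%:~R :> R.
    by rewrite ler0z mx_normrE; apply/bigmax_geP; left.
  by move=> /le_trans/(_ AT); rewrite leNgt T0.
pose k := Num.truncn T.
pose f (B : 'M['I_(k + k).+1]_n) : 'M[int]_n :=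
  map_mx (fun x : 'I_(k + k).+1 => (nat_of_ord x)%:Z - k%:Z) B.
apply: (@sub_finite_set _ _ (f @` setT)); last exact/finite_image/finite_finset.
move=> A /=/(mx_norm_intP _ T0) AT.
have Ak i j : `|A i j| <= k%:Z.
  have := AT i j; rewrite -abszE lez_nat -pmulrn.
  by rewrite -truncn_ge_nat.
exists (\matrix_(i, j) inord (absz (A i j + k%:Z))) => //.
apply/matrixP => i j; rewrite !mxE inordK.
  have := Ak i j; rewrite ler_norml => /andP[kA _].
  by rewrite gez0_abs ?addrK // -lerBlDr sub0r.
rewrite ltnS -lez_nat abszE (le_trans (ler_normD _ _)) // PoszD.
by rewrite lerD // Ak.
Qed.

Lemma finite_factorizations (R : realType) (n : nat) (T : R) (M : 'M[int]_n) :
  finite_set (factorizations T M).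
Proof.
apply: (sub_finite_set _
  (finite_setX (@finite_mx_norm_le R n T) (@finite_mx_norm_le R n T))).
by move=> AB /= [].
Qed.

(* [fset_set] sends infinite sets to the empty one; the set here is always
   finite by [finite_factorizations]. *)
Definition tau (R : realType) (n : nat) (T : R) (M : 'M[int]_n) : nat :=
  #|` fset_set (factorizations T M)|.

(* Main.v *)
Require Import Defs.
From mathcomp Require Import all_boot all_order all_fingroup all_algebra.
From mathcomp Require Import all_classical all_reals.
From mathcomp Require Import topology normedtype.
From mathcomp Require Import zify ring.

Set Implicit Arguments.
Unset Strict Implicit.
Unset Printing Implicit Defensive.

Import Order.TTheory GRing.Theory Num.Theory.

Local Open Scope ring_scope.

(** Why the bound holds.  The Smith normal form gives M = P Q over the integers,
    where P has r columns and a left inverse ([int_rank_factorization]).  For a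
    unimodular U of size r and any integer matrix Z with n - r rows, the pair
      A = [P U | 0],   B = [U^-1 Q ; Z]
    factors M, and distinct pairs (U, Z) give distinct pairs (A, B).  The free
    block Z contributes T^(n(n-r)), so everything reduces to producing a constant
    times T^(floor(r^2/2)) unimodular U with both U and U^-1 of size O(T)
    ([many_unimodular]).

    These U come from lattices.  Write r = m + s + m with s = 0 or 1, so that
    floor(r^2/2) = 2m(m+s), let t be of order T, and consider the row lattice of
          [ 1  b   C   ]
      A = [ 0  t   t d ]  =  D L,   D = diag(1, t, t^2),  L unipotent,
          [ 0  0   t^2 ]
    with the entries of b and d in [0, t) and those of C in [0, t^2).  There are
    t^(2m(m+s)) such lattices, all of covolume t^r.
    - At least half of them contain no nonzero vector of size less than a small
      multiple of t: this is a union bound over the first block x of the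
      coordinates, because the short vectors with x = 0 vanish and, given x, the
      remaining conditions hold for a small proportion of the C
      ([card_has_short_vector],
      [card_has_short_vector_half]).
    - A lattice of covolume t^r without such short vectors has r independent
      vectors of size O(t).  Only the pigeonhole principle is needed: for every
      hyperplane it produces a vector of size O(t) off the hyperplane
      ([lattice_off_hyperplane], [reduced_transform]).
    - Let the rows of V A be these vectors.  Since A^-1 = O(1) and A = O(t^2), the
      matrices V and adj V are O(t) while det V is bounded.  Moreover V determines
      the lattice up to boundedly many choices: if V D L and V D L' are both O(t)
      then L^-1 L' = (V D L)^-1 (V D L') is a bounded integer matrix
      ([bounded_transform], [bounded_adj_transform], [bounded_quotient]).
    - Finally V = U W with U unimodular and W in a finite set independent of t
      ([bounded_right_factor]), so the many V yield as many U up to a constant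
      ([many_unimodular_blocks]). *)

(** * Counting and entry bounds *)

Lemma size_le_fibers (T U : eqType) (f : T -> U) (s : seq T) (k : nat) :
  (forall u, (count (fun x => f x == u) s <= k)%N) ->
  (size s <= k * size (undup (map f s)))%N.
Proof.
move=> fk; have : {subset map f s <= undup (map f s)}.
  by move=> u; rewrite mem_undup.
have: uniq (undup (map f s)) by apply: undup_uniq.
move: (undup (map f s)) => r; elim: r s fk => [|u r IHr] s fk /=.
  by move=> _; case: s {fk} => // x s /(_ (f x)); rewrite mem_head => /(_ isT).
move=> /andP[ur r_uniq] sub; rewrite mulnS -(count_predC (fun x => f x == u) s).
apply: leq_add; first exact: fk.
rewrite -size_filter; apply: IHr => // [v|v /mapP[x]].
  by apply: leq_trans (fk v); rewrite count_filter; apply: sub_count => x /andP[].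
rewrite mem_filter => /andP[/= xu xs] ->.
by have := sub (f x) (map_f f xs); rewrite inE (negbTE xu).
Qed.

Lemma card_union_bound (T X : finType) (P : pred T) (B : X -> pred T) (k : nat) :
  (forall g, P g -> exists x, B x g) -> (forall x, #|B x| <= k)%N ->
  (#|P| <= #|X| * k)%N.
Proof.
move=> PB Bk; rewrite -sum1_card -sum_nat_const.
apply: leq_trans (_ : \sum_(x : X) \sum_(g | B x g) 1 <= _)%N; last first.
  by apply: leq_sum => x _; rewrite sum1_card.
rewrite (exchange_big_dep predT) //= [leqRHS](bigID P) /=.
apply: leq_trans (leq_addr _ _); apply: leq_sum => g /PB[x Bxg].
by rewrite sum1_card; apply/card_gt0P; exists x.
Qed.

Definition bounded_mx (m n B : nat) (A : 'M[int]_(m, n)) :=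
  forall i j, (`|A i j| <= B)%N.

Lemma size_bounded_mx (m n B : nat) (s : seq 'M[int]_(m, n)) :
  uniq s -> (forall A, A \in s -> bounded_mx B A) ->
  (size s <= (B + B).+1 ^ (m * n))%N.
Proof.
move=> s_uniq sB.
pose f (A : 'M[int]_(m, n)) : 'M['I_(B + B).+1]_(m, n) :=
  \matrix_(i, j) inord (absz (A i j + B%:Z)).
rewrite -[X in (X ^ _)%N]card_ord -card_mx -(size_map f) cardE.
apply: uniq_leq_size => [|A _]; last by rewrite mem_enum.
rewrite map_inj_in_uniq // => A A' /sB AB /sB A'B /matrixP eqf.
apply/matrixP => i j; have := eqf i j; rewrite !mxE => /(congr1 val) /=.
have := AB i j; have := A'B i j.
by move=> h1 h2; rewrite !inordK; lia.
Qed.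

Lemma bounded_mulmx (m n p B C : nat) (X : 'M[int]_(m, n)) (Y : 'M[int]_(n, p)) :
  bounded_mx B X -> bounded_mx C Y -> bounded_mx (n * (B * C)) (X *m Y).
Proof.
move=> XB YC i j; rewrite -lez_nat abszE mxE.
apply: le_trans (ler_norm_sum _ _ _) _.
apply: le_trans (_ : \sum_(k < n) ((B * C)%N : int) <= _).
  by apply: ler_sum => k _; rewrite -abszE lez_nat abszM leq_mul.
by rewrite sumr_const card_ord; lia.
Qed.

Lemma bounded_det (n B : nat) (A : 'M[int]_n) :
  bounded_mx B A -> (`|\det A| <= n`! * B ^ n)%N.
Proof.
move=> AB; rewrite -lez_nat abszE /determinant.
apply: le_trans (ler_norm_sum _ _ _) _.
apply: le_trans (_ : \sum_(s : 'S_n) ((B ^ n)%N : int) <= _).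
  apply: ler_sum => s _; rewrite normrM normr_sign mul1r normr_prod.
  have -> : (B ^ n)%N = \prod_(i < n) B%:Z :> int.
    by rewrite prodr_const card_ord -natz natrX natz.
  by apply: ler_prod => i _; rewrite normr_ge0 -abszE lez_nat AB.
by rewrite sumr_const card_Sn; lia.
Qed.

Lemma bounded_adj (n B : nat) (A : 'M[int]_n) :
  bounded_mx B A -> bounded_mx (n.-1`! * B ^ n.-1) (\adj A).
Proof.
move=> AB i j; rewrite mxE /cofactor abszM absz_sign mul1n.
by apply: bounded_det => k l; rewrite !mxE.
Qed.

Lemma bounded_mx_ex (m n : nat) (A : 'M[int]_(m, n)) : exists B, bounded_mx B A.
Proof.
exists (\max_i \max_j absz (A i j))%N => i j.
apply: leq_trans (leq_bigmax (F := fun i => _) i).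
exact: (leq_bigmax (F := fun j => _) j).
Qed.

Lemma mulmx_det_neq0_inj (n : nat) (A B : 'M[int]_n) (V : 'M[int]_n) :
  \det V != 0 -> A *m V = B *m V -> A = B.
Proof.
move=> V0 /(congr1 (mulmx^~ (\adj V))); rewrite -!mulmxA mul_mx_adj.
rewrite !mul_mx_scalar => /matrixP AB; apply/matrixP => i j.
by have := AB i j; rewrite !mxE; apply: mulfI.
Qed.

(** * Short independent vectors in a lattice *)

(** The box of the integer points with coordinates in [0, K t) is coded by the
    class of a point modulo the lattice together with the side-u cells of all its
    coordinates except the j-th, where w is largest.  There are more points than
    codes, so two points share a code.  Their difference v lies in the lattice and
    is smaller than u outside j; were it orthogonal to w, the maximality of w_j
    would make it smaller than r u everywhere, against the lower bound on nonzero
    vectors.  There are (K t)^r points and t^r (K h)^(r-1) codes, which is why K has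
    to exceed h^(r-1). *)
Lemma lattice_off_hyperplane (r t u h K : nat) (a : 'I_r -> nat)
    (L LI : 'M[int]_r) (w : 'cV[rat]_r) :
  let A := diag_mx (\row_i (a i)%:Z) *m L in
  (0 < u)%N -> (0 < h)%N -> t = (h * u)%N -> (h ^ r.-1 < K)%N ->
  (\prod_i a i)%N = (t ^ r)%N -> LI *m L = 1%:M ->
  (forall z : 'rV_r, z != 0 -> exists i, (r * u <= `|(z *m A)%R 0%R i|)%N) ->
  w != 0 ->
  exists2 z : 'rV_r, bounded_mx (K * t) (z *m A) &
    map_mx intr (z *m A) *m w != 0.
Proof.
move=> A u0 h0 tE hK aE LIL noshort w0.
have [i0 wi0] : exists i, w i 0 != 0.
  apply: contrapT => /forallNP w_eq0; move/eqP: w0; apply.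
  by apply/matrixP => i j; rewrite ord1 mxE; have /negP := w_eq0 i; rewrite negbK => /eqP.
pose j := [arg max_(i > i0) `|w i 0|]%O.
have r0 : (0 < r)%N := leq_ltn_trans (leq0n _) (ltn_ord j).
have wj i : `|w i 0| <= `|w j 0|.
  by rewrite /j; case: arg_maxP => // k _ /(_ i); apply.
have wj0 : 0 < `|w j 0| by apply: lt_le_trans (wj i0); rewrite normr_gt0.
have a0 i : (0 < a i)%N.
  have : (0 < \prod_i a i)%N by rewrite aE expn_gt0 tE muln_gt0 u0 h0.
  by rewrite (bigD1 i) //= muln_gt0 => /andP[].
have K0 : (0 < K)%N by apply: leq_ltn_trans hK.
(* Modulus 1 discards the cell of coordinate j. *)
pose c i := if i == j then 1%N else (K * h)%N.
have c0 i : (0 < c i)%N by rewrite /c; case: ifP; rewrite // muln_gt0 K0.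
pose P := {ffun 'I_r -> 'I_(K * t)}.
pose row_of (p : P) : 'rV[int]_r := \row_i (p i)%:Z.
pose q (p : P) (i : 'I_r) : int := (row_of p *m LI) 0 i.
pose Q := {dffun forall i : 'I_r, ('I_(a i) * 'I_(c i))%type}.
pose code (p : P) : Q := [ffun i =>
  (Ordinal (ltn_pmod (absz (q p i %% a i)%Z) (a0 i)),
   Ordinal (ltn_pmod (p i %/ u) (c0 i)))].
have ltQP : (#|Q| < #|P|)%N.
  rewrite card_dep_ffun card_ffun !card_ord foldrE big_image /=.
  rewrite (eq_bigr (fun i => (a i * c i)%N)); last by move=> i _; rewrite card_prod !card_ord.
  rewrite big_split /= aE (bigD1 j) //= {1}/c eqxx mul1n.
  rewrite (eq_bigr (fun=> (K * h)%N)); last by move=> i ij; rewrite /c (negbTE ij).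
  rewrite prod_nat_const (_ : #|_| = r.-1); last first.
    by rewrite -[in RHS](card_ord r) -(cardC1 j).
  rewrite !expnMn mulnC ltn_pmul2r ?expn_gt0 ?tE ?muln_gt0 ?h0 ?u0 //.
  by rewrite -[in X in (_ < X)%N](prednK r0) expnSr ltn_pmul2l ?expn_gt0 ?K0.
have /injectivePn[p [p' pp' eq_code]] : ~~ injectiveb code.
  by apply/negP => /injectiveP/leq_card; rewrite leqNgt ltQP.
pose v := row_of p - row_of p'.
have eq_codei i : code p i = code p' i by rewrite eq_code.
pose z : 'rV[int]_r := \row_i ((v *m LI) ord0 i %/ a i)%Z.
have zA : z *m A = v.
  rewrite /A mulmxA -[RHS]mulmx1 -LIL [RHS]mulmxA; congr (_ *m _).
  apply/rowP => i; rewrite mul_mx_diag [LHS]mxE [z 0 i]mxE [X in _ * X]mxE.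
  have ai : (a i)%:Z != 0 by have := a0 i; lia.
  have ai0 : 0 < (a i)%:Z by have := a0 i; lia.
  have absq p1 : (absz (q p1 i %% a i)%Z < a i)%N.
    by have := ltz_pmod (q p1 i) ai0; have := modz_ge0 (q p1 i) ai; lia.
  have := eq_codei i; rewrite !ffunE => -[+ _]; rewrite !modn_small // => eqm.
  rewrite divzK // (_ : (_ *m _) ord0 i = q p i - q p' i); last first.
    by rewrite mulmxBl [LHS]mxE [X in _ + X = _]mxE.
  rewrite -eqz_mod_dvd; apply/eqP.
  have := modz_ge0 (q p i) ai; have := modz_ge0 (q p' i) ai; lia.
have vE i : v ord0 i = (p i)%:Z - (p' i)%:Z by rewrite !mxE.
have v_small i : i != j -> (`|v ord0 i| < u)%N.
  move=> ij; have := eq_codei i; rewrite !ffunE => -[_] /eqP.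
  have div_lt (x : 'I_(K * t)) : (x %/ u < K * h)%N.
    by rewrite ltn_divLR // -mulnA -tE.
  rewrite /c (negbTE ij) !modn_small // => /eqP eqd.
  rewrite vE; have := divn_eq (p i) u; have := divn_eq (p' i) u.
  rewrite eqd; have := ltn_pmod (p i) u0; have := ltn_pmod (p' i) u0.
  move: (p' i %/ u)%N (p i %% u)%N (p' i %% u)%N => d m1 m2 lt2 lt1 -> ->; lia.
have z0 : z != 0.
  apply: contra_neq pp' => z0; apply/ffunP => i; apply/val_inj => /=.
  have := vE i; rewrite -zA z0 mul0mx mxE => /esym/eqP.
  by rewrite subr_eq0 eqz_nat => /eqP.
exists z.
  move=> k i; rewrite ord1 zA vE.
  have := ltn_ord (p i); have := ltn_ord (p' i); lia.
rewrite zA; apply/eqP => vw0.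
have vj : (`|v ord0 j| <= r.-1 * u)%N.
  have : `|(v ord0 j)%:~R * w j 0| <= (r.-1 * u)%:R * `|w j 0|.
    have /rowP/(_ 0) := vw0; rewrite !mxE (bigD1 j) //= !mxE => /eqP.
    rewrite addr_eq0 => /eqP ->; rewrite normrN.
    apply: le_trans (ler_norm_sum _ _ _) _.
    apply: le_trans (_ : \sum_(i < r | i != j) u%:R * `|w j 0| <= _).
      apply: ler_sum => i ij; rewrite normrM !mxE ler_pM //.
      by rewrite -vE -intr_norm -abszE ler_nat ltnW ?v_small.
    rewrite (eq_bigl (mem (predC1 j))) // sumr_const cardC1 card_ord.
    by rewrite natrM -mulrA [X in _ <= X]mulr_natl.
  rewrite normrM ler_pM2r // -intr_norm -abszE.
  by rewrite ler_nat.
have [i] := noshort _ z0; rewrite zA -[X in (X * u)%N](prednK r0) mulSn => ge_i.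
have [ij|/v_small lt_i] := eqVneq i j.
  by move: ge_i; rewrite ij => /leq_trans/(_ vj); lia.
by have := leq_ltn_trans (leq_trans (leq_addr _ _) ge_i) lt_i; rewrite ltnn.
Qed.

(** Rows are chosen greedily: as long as there are fewer than r of them, some w
    kills them all, and a row not killed by w increases the rank. *)
Lemma full_rank_selection (r : nat) (S : 'rV[int]_r -> Prop) :
  (forall w : 'cV[rat]_r, w != 0 -> exists2 v, S v & map_mx intr v *m w != 0) ->
  exists2 B : 'M[int]_r, (forall i, S (row i B)) & \det B != 0.
Proof.
move=> offS.
have [B SB free_B] : exists2 B : 'M[int]_r, (forall i, S (row i B)) &
    row_free (map_mx intr B : 'M[rat]_r).
  suff build k : (k <= r)%N -> exists2 B : 'M[int]_(k, r),
      (forall i, S (row i B)) & row_free (map_mx intr B : 'M[rat]_(k, r)).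
    exact: build (leqnn r).
  elim: k => [_|k IHk lt_kr].
    by exists 0 => [[]//|]; rewrite /row_free flatmx0 mxrank0.
  have [B SB /eqP rank_B] := IHk (ltnW lt_kr).
  pose BQ : 'M[rat]_(k, r) := map_mx intr B.
  have /existsP[j wj0] : [exists j, col j (cokermx BQ) != 0].
    apply: contraTT lt_kr; rewrite negb_exists => /forallP coker0.
    have : cokermx BQ = 0.
      apply/matrixP => i j; have := coker0 j; rewrite negbK => /eqP/colP/(_ i).
      by rewrite !mxE.
    move=> /(congr1 mxrank); rewrite mxrank_coker mxrank0 rank_B => /eqP.
    by rewrite subn_eq0 -leqNgt.
  have [v Sv vw] := offS _ wj0.
  exists (col_mx v B : 'M_(1 + k, r)).
    suff rowS (i : 'I_(1 + k)) : S (row i (col_mx v B)) by exact: rowS.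
    case: (split_ordP i) => [i' ->|i' ->]; last by rewrite rowKd.
    by rewrite rowKu (_ : row i' v = v) // ord1 row_id.
  suff : row_free (map_mx intr (col_mx v B) : 'M[rat]_(1 + k, r)) by [].
  rewrite map_col_mx /row_free eqn_leq rank_leq_row -addsmxE add1n.
  rewrite -[X in (X < _)%N]rank_B; apply: rank_ltmx.
  rewrite addsmxC /ltmx addsmxSl /= addsmx_sub submx_refl /=.
  apply: contra vw => /submxP[x ->].
  by rewrite colE mulmxA -(mulmxA x) mulmx_coker mulmx0 mul0mx.
exists B => //; move: free_B; rewrite row_free_unit unitmxE det_map_mx unitfE.
by rewrite intr_eq0.
Qed.

(** * The transition matrix to a short basis *)

Section Transform.
Variables (r t : nat) (a : 'I_r -> nat).
Hypothesis t0 : (0 < t)%N.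
Hypothesis prod_a : (\prod_i a i)%N = (t ^ r)%N.
Local Notation D := (diag_mx (\row_i (a i)%:Z)).

Lemma det_scale : \det D = (t ^ r)%N.
Proof.
rewrite det_diag -prod_a -natz natr_prod; apply: eq_bigr => i _.
by rewrite mxE natz.
Qed.

Lemma reduced_transform (u h K : nat) (L LI : 'M[int]_r) :
  (0 < u)%N -> (0 < h)%N -> t = (h * u)%N -> (h ^ r.-1 < K)%N -> LI *m L = 1%:M ->
  (forall z : 'rV_r, z != 0 ->
     exists i, (r * u <= `|(z *m (D *m L))%R 0%R i|)%N) ->
  exists2 V : 'M[int]_r, \det V != 0 & bounded_mx (K * t) (V *m (D *m L)).
Proof.
move=> u0 h0 tE hK LIL noshort.
pose S (v : 'rV[int]_r) := exists z : 'rV_r,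
  bounded_mx (K * t) (z *m (D *m L)) /\ v = z *m (D *m L).
have [w w0|B SB detB] := @full_rank_selection r S.
  have [z zK zw] := lattice_off_hyperplane u0 h0 tE hK prod_a LIL noshort w0.
  by exists (z *m (D *m L)) => //; exists z.
have [z zP] := fin_all_exists SB.
have VB : (\matrix_i z i) *m (D *m L) = B.
  by apply/row_matrixP => i; rewrite row_mul rowK; case: (zP i).
exists (\matrix_i z i).
  by move: detB; rewrite -VB det_mulmx mulf_eq0 negb_or => /andP[].
by move=> i j; have [/(_ 0 j)] := zP i; rewrite VB => + rowB; rewrite -rowB mxE.
Qed.

(** Column j of A^-1 = L^-1 D^-1 is bounded by c, because the j-th column of L^-1
    is at most c times the entry a j that D^-1 divides it by. *)
Lemma bounded_transform (c K : nat) (V L LI : 'M[int]_r) :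
  L *m LI = 1%:M -> (forall k j, `|LI k j| <= c * a j)%N ->
  bounded_mx (K * t) (V *m (D *m L)) -> bounded_mx (r * (c * (K * t))) V.
Proof.
move=> LLI LIa VK i j.
have a0 : (0 < a j)%N.
  by have := expn_gt0 t r; rewrite t0 -prod_a (bigD1 j) //= muln_gt0 => /andP[].
have : V i j * (a j)%:Z = (V *m (D *m L) *m LI) i j.
  by rewrite -!mulmxA LLI mulmx1 mul_mx_diag !mxE.
rewrite mxE => VE; rewrite -(leq_pmul2r a0) -[X in (_ * X <= _)%N]/(absz (a j)) -abszM VE.
rewrite -lez_nat abszE; apply: le_trans (ler_norm_sum _ _ _) _.
apply: le_trans (_ : \sum_(k < r) ((K * t * (c * a j))%N : int) <= _).
  by apply: ler_sum => k _; rewrite -abszE lez_nat abszM leq_mul.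
by rewrite sumr_const card_ord; lia.
Qed.

Lemma bounded_det_transform (K : nat) (V L : 'M[int]_r) :
  \det L = 1 -> bounded_mx (K * t) (V *m (D *m L)) ->
  (`|\det V| <= r`! * K ^ r)%N.
Proof.
move=> detL /bounded_det; rewrite !det_mulmx detL mulr1 det_scale abszM expnMn mulnA.
by rewrite leq_pmul2r // expn_gt0 t0.
Qed.

(** With A = D L one has t^r adj V = A adj (V A), where A is at most t^2 and
    adj (V A) is of order t^(r-1). *)
Lemma bounded_adj_transform (K : nat) (V L : 'M[int]_r) :
  (0 < r)%N -> \det V != 0 -> \det L = 1 -> bounded_mx (t ^ 2) (D *m L) ->
  bounded_mx (K * t) (V *m (D *m L)) ->
  bounded_mx (r`! * K ^ r.-1 * t) (\adj V).
Proof.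
move=> r0 V0 detL At VK i j.
pose A := D *m L.
have detA : \det A = (t ^ r)%N by rewrite det_mulmx detL mulr1 det_scale.
have adjE : (t ^ r)%N%:Z *: \adj V = A *m \adj (V *m A).
  have : \det V *: (A *m \adj (V *m A)) = \det V *: (\det A *: \adj V).
    rewrite -mul_scalar_mx -mul_adj_mx -(mulmxA (\adj V) V) (mulmxA V A) mul_mx_adj.
    by rewrite mul_mx_scalar det_mulmx scalerA.
  rewrite -detA => /matrixP eqA; apply/matrixP => i1 j1.
  by have := eqA i1 j1; rewrite [LHS]mxE [RHS]mxE => /(mulfI V0).
have := bounded_mulmx At (bounded_adj VK) i j; rewrite -adjE mxE abszM /= => le_ij.
have tr0 : (0 < t ^ r)%N by rewrite expn_gt0 t0.
rewrite -(leq_pmul2l tr0); apply: leq_trans le_ij _.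
case: (r) r0 => // r1 _; rewrite factS expnMn !expnS /=.
by apply/eq_leq; ring.
Qed.

(** The integer matrix L1^-1 L2 equals (V D L1)^-1 (V D L2), that is
    adj (V D L1) (V D L2) divided by a determinant of absolute value at least t^r,
    while the product itself is of order t^r. *)
Lemma bounded_quotient (K : nat) (V L1 L2 L1I : 'M[int]_r) :
  (0 < r)%N -> \det V != 0 -> \det L1 = 1 -> L1 *m L1I = 1%:M ->
  bounded_mx (K * t) (V *m (D *m L1)) -> bounded_mx (K * t) (V *m (D *m L2)) ->
  bounded_mx (r`! * K ^ r) (L1I *m L2).
Proof.
move=> r0 V0 detL1 LI1 VK1 VK2 i j.
have : \det (V *m (D *m L1)) *: (L1I *m L2)
    = \adj (V *m (D *m L1)) *m (V *m (D *m L2)).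
  rewrite -mul_scalar_mx -mul_adj_mx -!mulmxA; congr (_ *m (_ *m (_ *m _))).
  by rewrite mulmxA LI1 mul1mx.
rewrite !det_mulmx detL1 mulr1 det_scale => /matrixP/(_ i j); rewrite mxE => eq_ij.
have := bounded_mulmx (bounded_adj VK1) VK2 i j; rewrite -eq_ij !abszM /=.
rewrite -mulnA => le_ij.
have tr0 : (0 < t ^ r)%N by rewrite expn_gt0 t0.
rewrite -(leq_pmul2l tr0).
apply: leq_trans (leq_trans _ le_ij) _; first by rewrite leq_pmull // absz_gt0.
case: (r) r0 => // r1 _; rewrite factS expnMn !expnS /=.
by apply/eq_leq; ring.
Qed.

End Transform.

(** * Removing a bounded determinant *)

(** The matrices V with nonzero determinant at most d fall into finitely many
    classes, given by det V and by V modulo d!.  If W represents the class of V,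
    then V = W + (det V) E with E integral, whence V = (1 + E adj W) W and
    W = (1 - E adj V) V.  So W is a right factor up to a unimodular matrix, and
    it is bounded since it is one of finitely many representatives. *)
Lemma bounded_right_factor (r d : nat) :
  exists K : nat, forall V : 'M[int]_r, \det V != 0 -> (`|\det V| <= d)%N ->
    exists U U' W : 'M[int]_r,
      [/\ U *m U' = 1%:M, V = U *m W, W = U' *m V & bounded_mx K W].
Proof.
pose N := d`!.
pose ok (V : 'M[int]_r) := \det V != 0 /\ (`|\det V| <= d)%N.
pose cl (V : 'M[int]_r) : 'I_(d + d).+1 * 'M['I_N.-1.+1]_r :=
  (inord (absz (\det V + d%:Z)), \matrix_(i, j) inord (absz (V i j %% N)%Z)).
have NE : N = N.-1.+1 by rewrite prednK ?fact_gt0.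
have [W okW] : exists W : _ -> 'M[int]_r, forall c V, ok V -> cl V = c ->
    ok (W c) /\ cl (W c) = c.
  have choose_rep c : exists W : 'M[int]_r, forall V, ok V -> cl V = c ->
      ok W /\ cl W = c.
    have [[W okW]|noW] := pselect (exists W, ok W /\ cl W = c).
      by exists W.
    by exists 0 => V okV clV; case: noW; exists V.
  by have [W] := choice choose_rep; exists W.
exists (\max_c \max_i \max_j absz (W c i j))%N => V V0 Vd.
have okV : ok V by [].
have [[W0 Wd] clW] := okW _ _ okV (erefl (cl V)).
have WK : bounded_mx (\max_c \max_i \max_j absz (W c i j)) (W (cl V)).
  move=> i j; apply: leq_trans (leq_bigmax (F := fun c => _) (cl V)).
  apply: leq_trans (leq_bigmax (F := fun i => _) i).
  exact: (leq_bigmax (F := fun j => _) j).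
move: (W (cl V)) W0 Wd clW WK => W' W0 Wd [/(congr1 val)/= eq_det /matrixP eq_mod] WK.
have detWV : \det W' = \det V by move: eq_det; rewrite !inordK; lia.
have dvd_detN : (\det V %| N%:Z)%Z.
  rewrite dvdzE; apply: dvdn_fact; rewrite Vd andbT; lia.
have [E VE] : exists E : 'M[int]_r, V = W' + \det V *: E.
  exists (\matrix_(i, j) ((V i j - W' i j) %/ \det V)%Z).
  apply/matrixP => i j; rewrite !mxE mulrC divzK; first by ring.
  apply: dvdz_trans dvd_detN _; rewrite -eqz_mod_dvd.
  have := eq_mod i j; rewrite !mxE => /(congr1 val)/=.
  have N0 : (0 < N)%N by rewrite fact_gt0.
  have mod_lt (x : int) : (absz (x %% N)%Z < N)%N.
    by have := ltz_pmod x (_ : 0 < N%:Z); have := modz_ge0 x (_ : N%:Z != 0); lia.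
  rewrite !inordK -?NE // => eqm; apply/eqP.
  have := modz_ge0 (V i j) (_ : N%:Z != 0).
  have := modz_ge0 (W' i j) (_ : N%:Z != 0); lia.
have UW : (1%:M + E *m \adj W') *m W' = V.
  by rewrite mulmxDl mul1mx -mulmxA mul_adj_mx mul_mx_scalar detWV -VE.
have U'V : (1%:M - E *m \adj V) *m V = W'.
  by rewrite mulmxBl mul1mx -mulmxA mul_adj_mx mul_mx_scalar {1}VE addrK.
exists (1%:M + E *m \adj W'), (1%:M - E *m \adj V), W'; split=> //.
by apply: (mulmx_det_neq0_inj V0); rewrite mul1mx -mulmxA U'V UW.
Qed.

(** * A family of lattices of covolume t^r *)

Lemma split_lshift (m n : nat) (i : 'I_m) : fintype.split (lshift n i) = inl i.
Proof. exact: (unsplitK (inl i)). Qed.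

Lemma split_rshift (m n : nat) (i : 'I_n) : fintype.split (rshift m i) = inr i.
Proof. exact: (unsplitK (inr i)). Qed.

Section LatticeFamily.
Variables m s : nat.

Definition upper_mx (b : 'M[int]_(m, s)) (C : 'M[int]_m) (d : 'M[int]_(s, m)) :
    'M[int]_(m + s + m) :=
  block_mx (block_mx 1%:M b 0 1%:M) (col_mx C d) 0 1%:M.

Definition upper_mx_inv (b : 'M[int]_(m, s)) (C : 'M[int]_m) (d : 'M[int]_(s, m)) :
    'M[int]_(m + s + m) :=
  block_mx (block_mx 1%:M (- b) 0 1%:M) (col_mx (b *m d - C) (- d)) 0 1%:M.

Lemma upper_mxV b C d : upper_mx b C d *m upper_mx_inv b C d = 1%:M.
Proof.
rewrite mulmx_block mulmx_block mul_block_col !mulmx1 !mul1mx !mulmx0 !mul0mx.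
rewrite !addr0 !add0r add_col_mx mulmxN !addNr addrAC subrK subrr col_mx0.
by rewrite -!scalar_mx_block.
Qed.

Lemma det_upper_mx b C d : \det (upper_mx b C d) = 1.
Proof. by rewrite /upper_mx !det_ublock !det1 !mulr1. Qed.

Definition scale (t : nat) (i : 'I_(m + s + m)) : nat :=
  match fintype.split i with
  | inl j => match fintype.split j with inl _ => 1 | inr _ => t end
  | inr _ => t ^ 2
  end.

Lemma prod_scale (t : nat) : (\prod_i scale t i = t ^ (m + s + m))%N.
Proof.
rewrite !big_split_ord /=.
under eq_bigr do rewrite /scale !split_lshift.
rewrite big1 // mul1n.
under eq_bigr do rewrite /scale split_lshift split_rshift.
under [X in (_ * X)%N]eq_bigr do rewrite /scale split_rshift.
rewrite !prod_nat_const !card_ord -expnM -expnD; congr expn; lia.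
Qed.

Local Notation D t := (diag_mx (\row_i (scale t i)%:Z)).

Lemma mul_scale (t : nat) (x : 'rV[int]_m) (y : 'rV[int]_s) (w : 'rV[int]_m) :
  row_mx (row_mx x y) w *m D t = row_mx (row_mx x (t%:Z *: y)) ((t ^ 2)%N%:Z *: w).
Proof.
apply/rowP => i; rewrite mul_mx_diag [LHS]mxE [X in _ * X]mxE /scale.
case: (split_ordP i) => [i1 ->|i1 ->]; rewrite ?split_lshift ?split_rshift ?row_mxEl ?row_mxEr.
  case: (split_ordP i1) => [i2 ->|i2 ->]; rewrite ?split_lshift ?split_rshift ?row_mxEl ?row_mxEr.
    by rewrite mulr1.
  by rewrite mxE mulrC.
by rewrite mxE mulrC.
Qed.

Lemma mul_upper (t : nat) (x : 'rV[int]_m) (y : 'rV[int]_s) (w : 'rV[int]_m) b C d :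
  row_mx (row_mx x y) w *m (D t *m upper_mx b C d) =
  row_mx (row_mx x (x *m b + t%:Z *: y))
    (x *m C + t%:Z *: (y *m d) + (t ^ 2)%N%:Z *: w).
Proof.
rewrite mulmxA mul_scale /upper_mx mul_row_block mul_row_block mul_row_col.
by rewrite !mulmx1 !mulmx0 !addr0 -!scalemxAl.
Qed.

Lemma bounded_upper_mx_inv (t : nat) (b : 'M[int]_(m, s)) C d :
  (0 < t)%N -> bounded_mx t b -> bounded_mx (t ^ 2) C -> bounded_mx t d ->
  forall k j, (`|upper_mx_inv b C d k j| <= s.+1 * scale t j)%N.
Proof.
move=> t0 bt Ct dt k j; have bdt := bounded_mulmx bt dt.
have tt : (t <= t ^ 2)%N by rewrite expnS expn1 leq_pmulr.
rewrite /upper_mx_inv /scale.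
case: (split_ordP k) => k1 ->; case: (split_ordP j) => j1 ->;
  rewrite ?split_lshift ?split_rshift ?block_mxEul ?block_mxEur ?block_mxEdl ?block_mxEdr.
- case: (split_ordP k1) => k2 ->; case: (split_ordP j1) => j2 ->;
  rewrite ?split_lshift ?split_rshift ?block_mxEul ?block_mxEur ?block_mxEdl ?block_mxEdr
    ?mxE //=; try by case: eqP; lia.
  by rewrite abszN (leq_trans (bt _ _)) // leq_pmull.
- case: (split_ordP k1) => k2 ->; rewrite ?col_mxEu ?col_mxEd; last first.
    by rewrite mxE abszN (leq_trans (dt _ _)) // (leq_trans tt) // leq_pmull.
  rewrite mxE [X in _ + X]mxE; have := bdt k2 j1; have := Ct k2 j1; rewrite mulnn.
  rewrite mulSn; move: (s * t ^ 2)%N (t ^ 2)%N ((b *m d) k2 j1) (C k2 j1); lia.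
- by rewrite mxE.
- by rewrite mxE; case: eqP => _; rewrite ?mulr1n ?mulr0n //=; lia.
Qed.

Lemma bounded_scale_upper (t : nat) (b : 'M[int]_(m, s)) C d :
  (0 < t)%N -> bounded_mx t b -> bounded_mx (t ^ 2) C -> bounded_mx t d ->
  bounded_mx (t ^ 2) (D t *m upper_mx b C d).
Proof.
move=> t0 bt Ct dt k j.
have tt : (t <= t ^ 2)%N by rewrite expnS expn1 leq_pmulr.
rewrite mul_diag_mx mxE [X in X * _]mxE /scale /upper_mx abszM.
case: (split_ordP k) => k1 ->; case: (split_ordP j) => j1 ->;
  rewrite ?split_lshift ?split_rshift ?block_mxEul ?block_mxEur ?block_mxEdl ?block_mxEdr.
- case: (split_ordP k1) => k2 ->; case: (split_ordP j1) => j2 ->;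
  rewrite ?split_lshift ?split_rshift ?block_mxEul ?block_mxEur ?block_mxEdl ?block_mxEdr
    ?mxE ?muln0 //=; try by case: eqP; lia.
  by rewrite mul1n (leq_trans (bt _ _)).
- case: (split_ordP k1) => k2 ->; rewrite ?split_lshift ?split_rshift ?col_mxEu ?col_mxEd.
    by rewrite mul1n Ct.
  by rewrite expnS expn1 leq_mul // dt.
- by rewrite mxE muln0.
- by rewrite mxE; case: eqP => _; rewrite ?mulr1n ?mulr0n //=; lia.
Qed.

End LatticeFamily.

(** * Few lattices of the family have a short vector *)

(** For 0 < a < delta and c < N, the number c a + s (with s reduced modulo N) meets
    at most a + 1 multiples of N, and for each multiple at most 2 delta / a + 1
    values of c fall in the window.  The pair made of the quotient by N and of the
    remainder divided by a thus separates the admissible c. *)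
Lemma card_near_multiples (N delta : nat) (a s : int) (P : pred 'I_N) :
  a != 0 -> (`|a| < delta)%N ->
  (forall c : 'I_N, P c -> exists w : int, `|c%:Z * a + s + N%:Z * w| < delta%:Z) ->
  (#|P| <= 5 * delta)%N.
Proof.
wlog a_gt0 : a s / 0 < a => [pos a0 ad near|].
  have [ag|al|ae] := ltgtP 0 a; [exact: (pos a s)| |by rewrite ae eqxx in a0].
  apply: (pos (- a) (- s)) => [|||c /near[w wd]]; [lia|lia|lia|].
  exists (- w); rewrite (_ : _ + _ = - (c%:Z * a + s + N%:Z * w)); last by ring.
  by rewrite normrN.
case: a a_gt0 => // k k0 _ kd near; have {}k0 : (0 < k)%N by lia.
have [N0|N0] := posnP N; first by apply: leq_trans (max_card _) _; rewrite card_ord N0.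
pose s' := absz ((s + delta%:Z) %% N)%Z.
have s'E : s'%:Z = ((s + delta%:Z) %% N%:Z)%Z.
  by rewrite /s' gez0_abs // modz_ge0 //; lia.
have s'N : (s' < N)%N by rewrite -ltz_nat s'E ltz_pmod //; lia.
have rem_small (c : 'I_N) : P c -> ((c * k + s') %% N < delta + delta)%N.
  move=> /near[w wd]; rewrite -ltz_nat -modz_nat PoszD PoszM s'E modzDmr.
  rewrite (_ : _ + _ = (c%:Z * k%:Z + s + N%:Z * w + delta%:Z) + (- w) * N%:Z); last by ring.
  rewrite addrC modzMDl; move: (c%:Z * k%:Z + s + N%:Z * w) wd => e wd.
  have [n nE] : exists n : nat, e + delta%:Z = n by exists (absz (e + delta%:Z)); lia.
  by rewrite nE modz_nat ltz_nat (leq_ltn_trans (leq_mod _ _)) //; lia.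
pose code (c : 'I_N) : 'I_k.+1 * 'I_((delta + delta) %/ k).+1 :=
  (inord ((c * k + s') %/ N), inord ((c * k + s') %% N %/ k)).
have code_inj : {in P &, injective code}.
  move=> c c' Pc Pc' [/(congr1 val)/= eqq /(congr1 val)/= eqr]; apply/val_inj => /=.
  have div_lt (x : 'I_N) : ((x * k + s') %/ N < k.+1)%N.
    rewrite ltn_divLR // mulSn addnC; have := ltn_ord x; nia.
  have rem_lt (x : 'I_N) : P x -> ((x * k + s') %% N %/ k < ((delta + delta) %/ k).+1)%N.
    by move=> Px; rewrite ltnS leq_div2r // ltnW // rem_small.
  rewrite !inordK ?div_lt // in eqq; rewrite !inordK ?rem_lt // in eqr.
  have e1 := divn_eq (c * k + s') N; have e2 := divn_eq (c' * k + s') N.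
  have f1 := divn_eq ((c * k + s') %% N) k; have f2 := divn_eq ((c' * k + s') %% N) k.
  rewrite eqq in e1; rewrite eqr in f1.
  have l1 := ltn_pmod ((c * k + s') %% N) k0; have l2 := ltn_pmod ((c' * k + s') %% N) k0.
  move: e1 e2 f1 f2 l1 l2; clear.
  move: ((c * k + s') %% N %% k)%N ((c' * k + s') %% N %% k)%N => x x'.
  move: ((c' * k + s') %% N %/ k)%N ((c' * k + s') %/ N)%N => y z.
  move: ((c * k + s') %% N)%N ((c' * k + s') %% N)%N => v v'.
  nia.
rewrite -(card_in_image code_inj).
apply: leq_trans (max_card _) _; rewrite card_prod !card_ord.
have := leq_divM (delta + delta) k; move: ((delta + delta) %/ k)%N => q; nia.
Qed.

(** All coordinates of g other than the i-th are free, and once they are fixed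
    [card_near_multiples] bounds the choices for the i-th one. *)
Lemma card_linear_near_multiples (m N delta : nat) (x : 'I_m -> int) (i : 'I_m) (s : int)
    (P : pred {ffun 'I_m -> 'I_N}) :
  (0 < N)%N -> x i != 0 -> (`|x i| < delta)%N ->
  (forall g, P g -> exists w : int,
     `|\sum_j (g j)%:Z * x j + s + N%:Z * w| < delta%:Z) ->
  (#|P| <= 5 * delta * N ^ m.-1)%N.
Proof.
move=> N0 xi0 xid near; rewrite cardE.
pose f (g : {ffun 'I_m -> 'I_N}) : {ffun 'I_m -> 'I_N} :=
  [ffun j => if j == i then Ordinal N0 else g j].
apply: leq_trans (size_le_fibers (f := f) (k := 5 * delta) _) _ => [g'|].
  pose ins (c : 'I_N) : {ffun 'I_m -> 'I_N} := [ffun j => if j == i then c else g' j].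
  pose Pi := [pred c : 'I_N | P (ins c)].
  rewrite -size_filter; apply: leq_trans (_ : #|[seq ins c | c in Pi]| <= _)%N.
    rewrite cardE; apply: uniq_leq_size => [|g]; first by rewrite filter_uniq // enum_uniq.
    rewrite mem_filter !mem_enum => /andP[/eqP fg Pg].
    have gE : g = ins (g i).
      apply/ffunP => j; rewrite ffunE; case: eqP => [-> //|/eqP/negbTE ji].
      by rewrite -fg ffunE ji.
    by rewrite [X in X \in _]gE fintype.image_f // inE /= -gE.
  apply: leq_trans (leq_image_card _ _) _.
  apply: (@card_near_multiples N delta (x i) (\sum_(j | j != i) (g' j)%:Z * x j + s)) => // c.
  move=> /near[w]; rewrite (bigD1 i) //= !ffunE eqxx => wd; exists w.
  rewrite addrA; move: wd; congr (`|_ + _ + _ + _| < _).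
  by apply: eq_bigr => j /negbTE ji; rewrite ffunE ji.
rewrite leq_mul2l; apply/orP; right.
pose F (j : 'I_m) := if j == i then pred1 (Ordinal N0) else predT.
apply: leq_trans (_ : #|family F| <= _)%N.
  rewrite cardE; apply: uniq_leq_size => [|g]; first exact: undup_uniq.
  rewrite mem_undup => /mapP[g' _ ->]; rewrite mem_enum; apply/familyP => j.
  by rewrite ffunE /F; case: ifP => _; rewrite inE.
rewrite card_family foldrE big_image /= (bigD1 i) //= /F eqxx card1 mul1n.
rewrite (eq_bigr (fun=> N)) => [|j /negbTE ->]; last by rewrite card_ord.
by rewrite (eq_bigl (mem (predC1 i))) // prod_nat_const cardC1 card_ord.
Qed.

Section ShortVectors.
Variables m s : nat.
Local Notation D t := (diag_mx (\row_i (scale (m := m) (s := s) t i)%:Z)).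

(** The block C is stored by columns, since the conditions that make a vector
    short constrain the columns of C independently. *)
Definition cols_mx (k : nat) (g : {ffun 'I_m -> {ffun 'I_m -> 'I_k}}) : 'M[int]_m :=
  \matrix_(i, j) (g j i)%:Z.

Definition has_short_vector (t delta : nat) (b : 'M[int]_(m, s)) (d : 'M[int]_(s, m))
    (g : {ffun 'I_m -> {ffun 'I_m -> 'I_(t ^ 2)}}) : bool :=
  `[< exists2 z : 'rV[int]_(m + s + m), z != 0 &
      forall i, (`|(z *m (D t *m upper_mx b (cols_mx g) d)) ord0 i| < delta)%N >].

(** A short vector is (x, x b + t y, x C + t y d + t^2 w).  If x = 0 the lattice
    entries t and t^2 force y = w = 0.  If x is nonzero, then x and b determine y
    because two admissible values would differ by less than 1, and each column of C
    satisfies a condition as in [card_linear_near_multiples].  Hence the two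
    factors: the number of x, and the number of C for a given x. *)
Lemma card_has_short_vector (t delta : nat) (b : 'M[int]_(m, s)) (d : 'M[int]_(s, m)) :
  (0 < t)%N -> (delta + delta <= t)%N ->
  (#|has_short_vector (t := t) delta b d| <=
     (delta + delta) ^ m * (5 * delta * (t ^ 2) ^ m.-1) ^ m)%N.
Proof.
move=> t0 dt.
pose xi (x : {ffun 'I_m -> 'I_(delta + delta)}) : 'rV[int]_m :=
  \row_i ((x i)%:Z - delta%:Z).
pose close (x : 'rV[int]_m) (y : 'rV[int]_s) :=
  forall j, (`|(x *m b + t%:Z *: y)%R ord0 j| < delta)%N.
pose B x (g : {ffun 'I_m -> {ffun 'I_m -> 'I_(t ^ 2)}}) := `[< [/\ xi x != 0,
  forall i, (`|xi x ord0 i| < delta)%N & exists2 y, close (xi x) y &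
  exists w : 'rV[int]_m, forall j,
    (`|(xi x *m cols_mx g + t%:Z *: (y *m d) + (t ^ 2)%N%:Z *: w)%R ord0 j| < delta)%N]>].
have tt : (t <= t ^ 2)%N by rewrite expnS expn1 leq_pmulr.
have -> : ((delta + delta) ^ m = #|{ffun 'I_m -> 'I_(delta + delta)}|)%N.
  by rewrite card_ffun !card_ord.
apply: (@card_union_bound _ _ _ B) => [g|x].
  move=> /asboolP[z z0 z_short].
  pose x := lsubmx (lsubmx z); pose y := rsubmx (lsubmx z); pose w := rsubmx z.
  have zE : z = row_mx (row_mx x y) w by rewrite !hsubmxK.
  have shortE := mul_upper t x y w b (cols_mx g) d; rewrite -zE in shortE.
  have x_short i : (`|x ord0 i| < delta)%N.
    by have := z_short (lshift m (lshift s i)); rewrite shortE !row_mxEl.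
  have y_short : close x y.
    by move=> i; have := z_short (lshift m (rshift m i)); rewrite shortE row_mxEl row_mxEr.
  have w_short i : (`|(x *m cols_mx g + t%:Z *: (y *m d) + (t ^ 2)%N%:Z *: w)%R ord0 i|
       < delta)%N.
    by have := z_short (rshift (m + s) i); rewrite shortE row_mxEr.
  have [x0|x0] := eqVneq x 0.
    have y0 : y = 0.
      apply/rowP => i; have := y_short i; rewrite x0 mul0mx add0r !mxE; nia.
    have w0 : w = 0.
      apply/rowP => i; have := w_short i.
      rewrite x0 y0 !mul0mx scaler0 addr0 add0r !mxE; nia.
    by move: z0; rewrite zE x0 y0 w0 !row_mx0 eqxx.
  have d0 (i : 'I_m) : (0 < delta + delta)%N by have := x_short i; lia.
  pose x' : {ffun 'I_m -> 'I_(delta + delta)} :=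
    [ffun i => Ordinal (ltn_pmod (absz (x ord0 i + delta%:Z)) (d0 i))].
  exists x'.
  have xiE : xi x' = x.
    apply/rowP => i; rewrite mxE ffunE /=.
    have := x_short i; rewrite (_ : 0 = ord0 :> 'I_1) //.
    by move: (x ord0 i) => e lt_e; rewrite modn_small; lia.
  by apply/asboolP; rewrite xiE; split=> //; exists y => //; exists w.
have [/existsP[g0 /asboolP[xi0 xid [y0 cy0 _]]]|B0] := boolP [exists g, B x g].
  have [i xi0i] : exists i, xi x ord0 i != 0.
    apply/existsP; apply: contraNT xi0; rewrite negb_exists => /forallP x0.
    by apply/eqP/rowP => i; rewrite [RHS]mxE; apply/eqP/negbNE/x0.
  (* All the short vectors above x share y0, so each column of C meets one window. *)
  have y_unique y : close (xi x) y -> y = y0.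
    have close_inj (e a a' : int) : (`|(e + t%:Z * a)%R| < delta)%N ->
        (`|(e + t%:Z * a')%R| < delta)%N -> a = a'.
      move=> lt_a lt_a'.
      have : (`|(t%:Z * (a - a'))%R| < t)%N by rewrite mulrBr; lia.
      by rewrite abszM /= -[X in (_ < X)%N]muln1 ltn_pmul2l //; lia.
    move=> cy; apply/rowP => j; apply: (close_inj ((xi x *m b) ord0 j)).
      by have := cy j; rewrite mxE [X in _ + X]mxE.
    by have := cy0 j; rewrite mxE [X in _ + X]mxE.
  pose R (j : 'I_m) : pred {ffun 'I_m -> 'I_(t ^ 2)} := fun g => `[< exists w : int,
    `|\sum_k (g k)%:Z * xi x ord0 k + t%:Z * (y0 *m d) ord0 j + (t ^ 2)%N%:Z * w|
      < delta%:Z >].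
  apply: leq_trans (_ : #|family R| <= _)%N.
    apply: subset_leq_card; apply/fintype.subsetP => g.
    move=> /asboolP[_ _ [y /y_unique-> [w wP]]]; apply/familyP => j.
    apply/asboolP; exists (w ord0 j); have := wP j; rewrite -ltz_nat abszE.
    rewrite [in X in X -> _]mxE [X in `|X + _|]mxE [X in `|_ + X|]mxE.
    rewrite [X in `|X + _ + _|]mxE [X in `|_ + X + _|]mxE.
    suff <- : \sum_k xi x ord0 k * cols_mx g k j = \sum_k (g j k)%:Z * xi x ord0 k by [].
    by apply: eq_bigr => k _; rewrite [cols_mx _ _ _]mxE mulrC.
  rewrite card_family foldrE big_image /=.
  have -> K : (K ^ m = \prod_(j < m) K)%N by rewrite prod_nat_const card_ord.
  apply: leq_prod => j _.
  apply: (card_linear_near_multiples (i := i) (x := fun k => xi x ord0 k)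
    (s := t%:Z * (y0 *m d) ord0 j)) => // [|g /asboolP //].
  by rewrite expn_gt0 t0.
rewrite (_ : #|B x| = 0%N) //; apply/eqP; rewrite -leqn0 leqNgt.
by apply: contra B0 => /card_gt0P[g Bg]; apply/existsP; exists g.
Qed.

End ShortVectors.

(** The constant 5 in t is what makes 2 (10 r^2 u^2)^m at most (t^2)^m, and it also
    gives 2 r u <= t. *)
Lemma card_has_short_vector_half (m s u : nat) (b : 'M[int]_(m, s)) (d : 'M[int]_(s, m)) :
  let r := (m + s + m)%N in let t := (5 * r * u)%N in
  (0 < m)%N -> (0 < u)%N ->
  (2 * #|has_short_vector (t := t) (r * u) b d| <= (t ^ 2) ^ (m * m))%N.
Proof.
move=> r t m0 u0; have r0 : (0 < r)%N by rewrite /r; lia.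
have t0 : (0 < t)%N by rewrite /t !muln_gt0 r0.
have := @card_has_short_vector m s t (r * u) b d t0; move: (#|_|) => N le_N.
have {le_N} : (N <= (r * u + r * u) ^ m * (5 * (r * u) * (t ^ 2) ^ m.-1) ^ m)%N.
  by apply: le_N; rewrite /t; nia.
move=> /(leq_mul (leqnn 2))/leq_trans; apply.
rewrite -expnMn mulnA expnMn -expnM mulnA.
have -> : ((t ^ 2) ^ (m * m) = (t ^ 2) ^ m * (t ^ 2) ^ (m.-1 * m))%N.
  by rewrite -expnD -{1}(prednK m0) mulSn.
rewrite leq_mul2r; apply/orP; right.
apply: leq_trans (_ : 2 ^ m * ((r * u + r * u) * (5 * (r * u))) ^ m <= _)%N.
  by rewrite leq_mul2r -[X in (X <= _)%N](expn1 2) leq_exp2l // m0 orbT.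
by rewrite -expnMn leq_exp2r // /t; nia.
Qed.

(** * Unimodular matrices with small inverse *)

Definition nat_mx (p q k : nat) (b : 'M['I_k]_(p, q)) : 'M[int]_(p, q) :=
  map_mx (fun x : 'I_k => (x : nat)%:Z) b.

Lemma bounded_nat_mx (p q k : nat) (b : 'M['I_k]_(p, q)) : bounded_mx k (nat_mx b).
Proof. by move=> i j; rewrite mxE /= ltnW. Qed.

Lemma nat_mx_inj (p q k : nat) : injective (@nat_mx p q k).
Proof.
move=> b b' /matrixP eqb; apply/matrixP => i j; apply/val_inj.
by have := eqb i j; rewrite !mxE => -[].
Qed.

Lemma bounded_cols_mx (m k : nat) (g : {ffun 'I_m -> {ffun 'I_m -> 'I_k}}) :
  bounded_mx k (cols_mx g).
Proof. by move=> i j; rewrite mxE /= ltnW. Qed.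

Lemma cols_mx_inj (m k : nat) : injective (@cols_mx m k).
Proof.
move=> g g' /matrixP eqg; apply/ffunP => j; apply/ffunP => i; apply/val_inj.
by have := eqg i j; rewrite !mxE => -[].
Qed.

(** Each lattice of the family without short vectors is sent to a triple
    (U, U^-1, W), where V = U W is its transition matrix.  The fibers of this map
    are bounded by [bounded_quotient], and forgetting W costs another bounded
    factor. *)
Lemma many_unimodular_blocks (m s : nat) : (0 < m)%N ->
  let r := (m + s + m)%N in
  exists C k : nat, (0 < k)%N /\ forall u : nat, (0 < u)%N ->
  exists l : seq ('M[int]_r * 'M[int]_r),
    [/\ uniq l,
        forall p, p \in l ->
          [/\ p.1 *m p.2 = 1%:M, bounded_mx (C * u) p.1 & bounded_mx (C * u) p.2]
      & (u ^ (2 * m * (m + s)) <= k * size l)%N].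
Proof.
move=> m0 r; have r0 : (0 < r)%N by rewrite /r; lia.
pose h := (5 * r)%N; pose K := (h ^ r)%N.
have h0 : (0 < h)%N by rewrite muln_gt0 r0.
have hK : (h ^ r.-1 < K)%N by rewrite ltn_exp2l ?prednK //; rewrite /h; lia.
have [K1 factor] := bounded_right_factor r (r`! * K ^ r).
(* k1 bounds the number of quotients L1^-1 L2 giving the same V, and k2 the number
   of right factors W. *)
pose k1 := ((r`! * K ^ r + r`! * K ^ r).+1 ^ (r * r))%N.
pose k2 := ((K1 + K1).+1 ^ (r * r))%N.
pose C1 := (r * (r * (s.+1 * (K * h)) * (r.-1`! * K1 ^ r.-1)))%N.
pose C2 := (r * (K1 * (r`! * K ^ r.-1 * h)))%N.
exists (C1 + C2)%N, (2 * k1 * k2)%N; split; first by rewrite !muln_gt0 !expn_gt0.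
move=> u u0; pose t := (h * u)%N.
have t0 : (0 < t)%N by rewrite muln_gt0 h0.
pose gT := {ffun 'I_m -> {ffun 'I_m -> 'I_(t ^ 2)}}.
pose bdT := ('M['I_t]_(m, s) * 'M['I_t]_(s, m))%type.
pose good (p : bdT * gT) :=
  ~~ has_short_vector (t := t) (r * u) (nat_mx p.1.1) (nat_mx p.1.2) p.2.
pose L (p : bdT * gT) := upper_mx (nat_mx p.1.1) (cols_mx p.2) (nat_mx p.1.2).
pose LI (p : bdT * gT) := upper_mx_inv (nat_mx p.1.1) (cols_mx p.2) (nat_mx p.1.2).
pose D : 'M[int]_r := diag_mx (\row_i (scale (m := m) (s := s) t i)%:Z).
have LLI p : L p *m LI p = 1%:M by apply: upper_mxV.
have detL p : \det (L p) = 1 by apply: det_upper_mx.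
have prodt := prod_scale m s t.
have L_inj : injective L.
  move=> [[b d] g] [[b' d'] g'] /eq_block_mx[/eq_block_mx[_ eqb _ _] /eq_col_mx[eqg eqd] _ _].
  by congr (_, _, _); [apply: nat_mx_inj eqb|apply: nat_mx_inj eqd|apply: cols_mx_inj eqg].
(* For each choice of b and d, at least half of the blocks C are good. *)
have many_good : (t ^ (2 * m * (m + s)) <= 2 * #|good|)%N.
  apply: leq_trans (_ : \sum_(bd : bdT) (t ^ 2) ^ (m * m) <= _)%N.
    rewrite sum_nat_const card_prod !card_mx !card_ord -!expnD -expnM -expnD.
    by rewrite leq_pexp2l //; nia.
  rewrite -sum1_card big_distrr /=.
  rewrite (eq_bigl (fun p : bdT * gT => predT p.1 && good (p.1, p.2))); last by case.
  rewrite -(pair_big_dep predT (fun bd g => good (bd, g)) (fun _ _ => 2 * 1)%N) /=.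
  apply: leq_sum => bd _; rewrite -big_distrr /= sum1_card.
  have := @card_has_short_vector_half m s u (nat_mx bd.1) (nat_mx bd.2) m0 u0.
  rewrite -/r -/h -/t => le_half.
  have := cardC (has_short_vector (t := t) (r * u) (nat_mx bd.1) (nat_mx bd.2)).
  rewrite !card_ffun !card_ord -expnM => eqC.
  have -> : #|(fun g => good (bd, g))| =
      #|predC (has_short_vector (t := t) (r * u) (nat_mx bd.1) (nat_mx bd.2))| by [].
  by move: le_half; rewrite -eqC !mul2n -!addnn leq_add2l leq_add2r.
pose P (p : bdT * gT) (x : ('M[int]_r * 'M[int]_r) * 'M[int]_r) :=
  [/\ x.1.1 *m x.1.2 = 1%:M, bounded_mx ((C1 + C2) * u) x.1.1,
      bounded_mx ((C1 + C2) * u) x.1.2, bounded_mx K1 x.2 &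
      \det (x.1.1 *m x.2) != 0 /\
      bounded_mx (K * t) ((x.1.1 *m x.2) *m (D *m L p))].
have exF p : exists x, good p -> P p x.
  have [|bad] := boolP (good p); last by exists (1%:M, 1%:M, 1%:M).
  move=> good_p.
  have noshort (z : 'rV_r) : z != 0 ->
      exists i, (r * u <= `|(z *m (D *m L p))%R 0%R i|)%N.
    move=> z0; apply: contrapT => /forallNP no_i; move: good_p; apply/negP/negPn.
    by apply/asboolP; exists z => // i; rewrite ltnNge; apply/negP/no_i.
  have [V V0 VK] := reduced_transform prodt u0 h0 erefl hK (mulmx1C (LLI p)) noshort.
  have bt := bounded_nat_mx p.1.1; have dt := bounded_nat_mx p.1.2.
  have gt := bounded_cols_mx p.2.
  have V_le := bounded_transform t0 prodt (LLI p)
    (bounded_upper_mx_inv t0 bt gt dt) VK.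
  have adjV_le := bounded_adj_transform t0 prodt r0 V0 (detL p)
    (bounded_scale_upper t0 bt gt dt) VK.
  have detV_le := bounded_det_transform t0 prodt (detL p) VK.
  have [U [U' [W [UU' VE WE W_le]]]] := factor V V0 detV_le.
  have W0 : \det W != 0.
    by move: V0; rewrite VE det_mulmx mulf_eq0 negb_or => /andP[].
  exists (U, U', W) => _; split => //=; last by rewrite -VE.
    move=> i j; have := bounded_mulmx V_le (bounded_adj W_le) i j.
    rewrite VE -mulmxA mul_mx_adj mul_mx_scalar mxE abszM => le_ij.
    have det_gt0 : (0 < `|\det W|)%N by rewrite absz_gt0.
    apply: leq_trans (leq_pmull _ det_gt0) (leq_trans le_ij _); rewrite -/r.
    rewrite (_ : (r * _ = C1 * u)%N); last by rewrite /C1 /t; ring.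
    by rewrite leq_mul2r leq_addr orbT.
  move=> i j; have := bounded_mulmx W_le adjV_le i j.
  rewrite WE -mulmxA mul_mx_adj mul_mx_scalar mxE abszM => le_ij.
  have det_gt0 : (0 < `|\det V|)%N by rewrite absz_gt0.
  apply: leq_trans (leq_pmull _ det_gt0) (leq_trans le_ij _); rewrite -/r.
  rewrite (_ : (r * _ = C2 * u)%N); last by rewrite /C2 /t; ring.
  by rewrite leq_mul2r leq_addl orbT.
have [F FP] := choice exF.
pose l1 := undup (map F (enum good)).
have l1P x : x \in l1 -> exists2 p, good p & P p x.
  rewrite mem_undup => /mapP[p]; rewrite mem_enum => good_p ->.
  by exists p => //; apply: FP.
have size_l1 : (#|good| <= k1 * size l1)%N.
  rewrite cardE; apply: size_le_fibers => x; rewrite -size_filter.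
  case fiberE : [seq p <- enum good | F p == x] => [//|p0 ps]; rewrite -fiberE.
  have fiberP p : p \in [seq p <- enum good | F p == x] -> P p x.
    by rewrite mem_filter mem_enum => /andP[/eqP <- good_p]; apply: FP.
  have [_ _ _ _ [V0 VK0]] : P p0 x by apply: fiberP; rewrite fiberE mem_head.
  rewrite -(size_map (fun p => LI p0 *m L p)); apply: size_bounded_mx.
    rewrite map_inj_uniq => [|p p']; first by rewrite filter_uniq // enum_uniq.
    by move=> /(congr1 (mulmx (L p0))); rewrite !mulmxA LLI !mul1mx => /L_inj.
  move=> A /mapP[p /fiberP[_ _ _ _ [_ VK]] ->].
  exact: (bounded_quotient t0 prodt r0 V0 (detL p0) (LLI p0) VK0 VK).
exists (undup (map fst l1)); split; first exact: undup_uniq.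
  by move=> q; rewrite mem_undup => /mapP[x /l1P[p _ [? ? ? _ _]] ->].
have size_l2 : (size l1 <= k2 * size (undup (map fst l1)))%N.
  apply: size_le_fibers => q; rewrite -size_filter -(size_map snd).
  apply: size_bounded_mx => [|W /mapP[x]].
    rewrite map_inj_in_uniq => [|[q1 W1] [q2 W2] /=]; first by rewrite filter_uniq ?undup_uniq.
    by rewrite !mem_filter /= => /andP[/eqP-> _] /andP[/eqP-> _] ->.
  by rewrite mem_filter => /andP[_ /l1P[p _ [_ _ _ W_le _]]] ->.
apply: leq_trans (_ : t ^ (2 * m * (m + s)) <= _)%N.
  by case: (2 * m * (m + s))%N => // e; rewrite leq_exp2r // leq_pmull.
rewrite -(mulnA (2 * k1)) -(mulnA 2 k1); apply: leq_trans many_good _; rewrite leq_mul2l /=.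
by apply: leq_trans size_l1 _; rewrite leq_mul2l size_l2 orbT.
Qed.

Lemma many_unimodular (r : nat) :
  exists C k : nat, (0 < k)%N /\ forall u : nat, (0 < u)%N ->
  exists l : seq ('M[int]_r * 'M[int]_r),
    [/\ uniq l,
        forall p, p \in l ->
          [/\ p.1 *m p.2 = 1%:M, bounded_mx (C * u) p.1 & bounded_mx (C * u) p.2]
      & (u ^ (r ^ 2 %/ 2) <= k * size l)%N].
Proof.
have [m [s [rE s1]]] : exists m s, r = (m + s + m)%N /\ (s <= 1)%N.
  exists r./2, (odd r : nat); split; last by case: odd.
  by rewrite -[LHS]odd_double_half -addnn; lia.
have expE : (r ^ 2 %/ 2 = 2 * m * (m + s))%N.
  rewrite rE (_ : (_ ^ 2 = (2 * m * (m + s)) * 2 + s)%N); last first.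
    by case: s s1 {rE} => [|[|//]] _; ring.
  by rewrite divnMDl // divn_small ?addn0.
rewrite {}expE; subst r; have [->|m0] := posnP m; last exact: many_unimodular_blocks.
exists 1%N, 1%N; split=> // u u0; exists [:: (1%:M, 1%:M)]; split=> //.
move=> _ /[!inE]/eqP->; rewrite /= mulmx1; split=> // i j;
  by rewrite mxE mul1n; case: eqP.
Qed.

(** * Factorizations of M *)

(** In the Smith normal form the divisibility chain puts the nonzero diagonal
    entries first, so there are exactly r of them, and the first r columns of the
    left unimodular factor form P. *)
Lemma int_rank_factorization (n r : nat) (M : 'M[int]_n) :
  \rank (map_mx intr M : 'M[rat]_n) = r ->
  exists (P : 'M[int]_(n, r)) (P' : 'M[int]_(r, n)) (Q : 'M[int]_(r, n)),
    M = P *m Q /\ P' *m P = 1%:M.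
Proof.
move=> rankM; have [L L_unit [R R_unit [d d_sorted ME]]] := int_Smith_normal_form M.
have [k [k_le d_neq0 d_eq0]] : exists k, [/\ (k <= n)%N,
    forall i, (i < k)%N -> d`_i != 0 & forall i, (k <= i < n)%N -> d`_i = 0].
  exists (find (fun i => d`_i == 0) (iota 0 n)).
  have k_le := find_size (fun i => d`_i == 0) (iota 0 n); rewrite size_iota in k_le.
  split=> // [i ik|i /andP[ki i_n]].
    by have := before_find 0%N ik; rewrite nth_iota ?(leq_trans ik) // => ->.
  have k_n := leq_ltn_trans ki i_n.
  have : has (fun i => d`_i == 0) (iota 0 n) by rewrite has_find size_iota.
  move=> /(nth_find 0%N); rewrite nth_iota // add0n => /eqP dk0.
  have [i_d|/(nth_default 0)//] := ltnP i (size d).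
  have := sorted_leq_nth dvdz_trans dvdzz 0 d_sorted.
  move=> /(_ _ i (leq_ltn_trans ki i_d) i_d ki).
  by rewrite dk0 dvd0z => /eqP.
pose E : 'M[int]_n := diag_mx (\row_i (if (i < k)%N then d`_i else 1)).
have {}ME : M = L *m (pid_mx k : 'M_(n, k)) *m ((pid_mx k : 'M_(k, n)) *m E *m R).
  rewrite {1}ME !mulmxA -(mulmxA L (pid_mx k)) mul_pid_mx !minnn.
  congr (_ *m _); rewrite -mulmxA; congr (_ *m _).
  apply/matrixP => i j; rewrite mul_mx_diag !mxE.
  case: eqP => [<-|_]; last by rewrite mul0r.
  case: ltnP => ik; rewrite ?mul1r ?mul0r ?mulr1n //.
  by rewrite d_eq0 // ik ltn_ord.
have kr : k = r.
  have map_unit (A : 'M[int]_n) : A \in unitmx -> map_mx intr A \in @unitmx rat n.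
    by rewrite !unitmxE det_map_mx; apply: rmorph_unit.
  have E_unit : map_mx intr E \in @unitmx rat n.
    rewrite unitmxE det_map_mx det_diag unitfE intr_eq0 prodf_seq_neq0.
    by apply/allP => i _; rewrite mxE; case: ifP => // /d_neq0.
  rewrite -rankM ME !map_mxM !map_pid_mx.
  rewrite !mulmxA mxrankMfree ?row_free_unit ?map_unit // mxrankMfree ?row_free_unit //.
  rewrite -mulmxA mul_pid_mx !minnn.
  by rewrite eqmxMfull ?row_full_unit ?map_unit // rank_pid_mx.
subst k; exists (L *m pid_mx r), (pid_mx r *m invmx L), (pid_mx r *m E *m R).
split=> //; rewrite -mulmxA (mulmxA (invmx L)) mulVmx // mul1mx.
by rewrite mul_pid_mx !minnn (minn_idPr k_le) pid_mx_1.
Qed.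

Lemma size_le_tau (R : realType) (n : nat) (T : R) (M : 'M[int]_n)
    (l : seq ('M[int]_n * 'M[int]_n)) :
  uniq l -> (forall p, p \in l -> factorizations T M p) -> (size l <= tau T M)%N.
Proof.
move=> l_uniq lP; rewrite /tau; apply: uniq_leq_size => // p pl.
rewrite in_fset_set; first exact/mem_set/lP.
exact: finite_factorizations.
Qed.

Lemma many_factorizations (R : realType) (n r : nat) (M : 'M[int]_n) :
  \rank (map_mx intr M : 'M[rat]_n) = r ->
  exists C k : nat, (0 < k)%N /\ forall (u : nat) (T : R),
    (0 < u)%N -> (C * u)%:R <= T ->
    (u ^ (r ^ 2 %/ 2 + n * (n - r)) <= k * tau T M)%N.
Proof.
move=> rankM; have [P [P' [Q [ME P'P]]]] := int_rank_factorization rankM.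
have [k0 nE] : exists k0, n = (r + k0)%N.
  by exists (n - r)%N; rewrite subnKC // -rankM rank_leq_row.
have [C [k [k_gt0 many]]] := many_unimodular r.
have [BP PB] := bounded_mx_ex P; have [BQ QB] := bounded_mx_ex Q.
pose C' := (r * (BP * C) + r * (C * BQ) + 1)%N.
exists C', k; split=> // u T u0 CT.
have [l [l_uniq lP l_size]] := many u u0.
subst n; pose Z := 'M['I_u]_(k0, r + k0).
pose f (p : 'M[int]_r * 'M[int]_r) (z : Z) : 'M[int]_(r + k0) * 'M[int]_(r + k0) :=
  (row_mx (P *m p.1) 0, col_mx (p.2 *m Q) (nat_mx z)).
have T_bound B (A : 'M[int]_(r + k0)) : (B <= C' * u)%N ->
    (forall i j, (`|A i j| <= B)%N) -> (mx_norm A)%:~R <= T.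
  move=> BC A_le; have T0 : 0 <= T by apply: le_trans CT; rewrite ler0n.
  apply/mx_norm_intP => // i j; apply: le_trans CT.
  by rewrite -abszE ler_nat (leq_trans (A_le _ _)).
have : (size [seq f p z | p <- l, z <- enum {: Z}] <= tau T M)%N.
  apply: size_le_tau => [|_ /allpairsP[[p z] [/= /lP[UU' U_le U'_le] _ ->]]].
    apply: allpairs_uniq => //; first exact: enum_uniq.
    move=> [x z] [x' z'] /allpairsP[[p y] [/= pl _ [-> _]]].
    move=> /allpairsP[[q y'] [/= ql _ [-> _]]].
    move=> [/eq_row_mx[eqU _] /eq_col_mx[_ /nat_mx_inj ->]].
    have /lP[UU' _ _] := pl; have /lP[VV' _ _] := ql.
    have {}eqU : p.1 = q.1 by rewrite -[LHS]mul1mx -[RHS]mul1mx -P'P -!mulmxA eqU.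
    have eqU' : p.2 = q.2.
      by rewrite -[LHS]mul1mx -(mulmx1C VV') -mulmxA -eqU UU' mulmx1.
    by rewrite [p]surjective_pairing [q]surjective_pairing eqU eqU'.
  split=> /=.
  - apply: (T_bound (r * (BP * C) * u)%N) => [|i j].
      by rewrite leq_mul2r /C' -addnA leq_addr orbT.
    case: (split_ordP j) => j1 ->; last by rewrite row_mxEr mxE.
    by rewrite row_mxEl -!mulnA; apply: bounded_mulmx.
  - apply: (T_bound (r * (C * BQ) * u + u)%N) => [|i j].
      by rewrite -mulSnr leq_mul2r /C' addn1 ltnS leq_addl orbT.
    case: (split_ordP i) => i1 ->.
      rewrite col_mxEu (leq_trans _ (leq_addr _ _)) //.
      by rewrite -mulnA mulnAC; apply: bounded_mulmx.
    by rewrite col_mxEd (leq_trans (bounded_nat_mx _ _ _)) // leq_addl.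
  - by rewrite mul_row_col mul0mx addr0 mulmxA -(mulmxA P) UU' mulmx1 ME.
rewrite size_allpairs -cardE card_mx card_ord addKn => le_tau.
apply: leq_trans (leq_mul (leqnn k) le_tau).
by rewrite mulnA expnD [(k0 * _)%N]mulnC leq_mul2r l_size orbT.
Qed.

Theorem theorem1p4 (R : realType) (n : nat) (hn : (1 <= n)%N)
    (M : 'M[int]_n) (r : nat)
    (hr : \rank (map_mx intr M : 'M[rat]_n) = r) :
  exists c : R, exists T0 : R,
    [/\ 0 < c, 1 <= T0 &
        forall T : R, T0 <= T ->
          c * T ^+ (r ^ 2 %/ 2 + n * (n - r)) <= (tau T M)%:R].
Proof.
have [C [k [k_gt0 many]]] := @many_factorizations R _ _ _ hr.
pose e := (r ^ 2 %/ 2 + n * (n - r))%N.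
exists (k%:R * (2 * C.+1)%:R ^+ e)^-1, C.+1%:R; split.
- by rewrite invr_gt0 mulr_gt0 ?exprn_gt0 ?ltr0n.
- by rewrite ler1n.
move=> T T_ge; rewrite -/e.
have C0 : 0 < C.+1%:R :> R by rewrite ltr0n.
have T_ge1 : 1 <= T / C.+1%:R by rewrite ler_pdivlMr ?mul1r.
have /andP[u_le u_gt] := truncn_itv (le_trans ler01 T_ge1).
(* The integer part u of T / (C + 1) is at least T / (2 (C + 1)), as it is nonzero. *)
move: (Num.truncn _) u_le u_gt => u u_le u_gt.
have u0 : (0 < u)%N.
  by have := le_lt_trans T_ge1 u_gt; rewrite ltr1n.
have CuT : (C * u)%:R <= T.
  rewrite ler_pdivlMr // in u_le; apply: le_trans u_le.
  by rewrite -natrM ler_nat mulnC leq_mul.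
have := many u T u0 CuT; rewrite -/e -(ler_nat R) natrX natrM => le_tau.
rewrite mulrC ler_pdivrMr ?mulr_gt0 ?exprn_gt0 ?ltr0n //.
apply: le_trans (_ : (2 * C.+1)%:R ^+ e * u%:R ^+ e <= _); last first.
  by rewrite mulrA [X in _ <= X]mulrC ler_wpM2l ?exprn_ge0 ?ler0n // mulrC.
rewrite -exprMn lerXn2r ?nnegrE ?mulr_ge0 ?ler0n //.
  by apply: le_trans T_ge; rewrite ler0n.
rewrite ltr_pdivrMr // in u_gt; apply: le_trans (ltW u_gt) _.
by rewrite -!natrM ler_nat mulnC (mulnC 2%N) -mulnA leq_mul // mul2n -addnn -addn1 leq_add.
Qed.
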